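(* If $G$ is an odd quadrangulation of a non-orientable surface, then $\mathrm{ind}(\mathrm{L}(G)) \geq 2$.
   Context: A quadrangulation of a non-orientable surface $S$ (graph embedded with every face bounded by a $4$-cycle) is odd if it contains an odd cycle $C$ such that cutting $S$ along $C$ yields an orientable surface. $\mathrm{L}(G)$ is the Lovász complex: the subcomplex of the barycentric subdivision of the neighborhood complex $\{A\subseteq V(G)\mid \mathrm{CN}(A)\neq\emptyset\}$ induced by the sets $A$ with $\mathrm{CN}^2(A)=A$ ($\mathrm{CN}$ = common neighbors), with its canonical free $\mathbb{Z}_2$-action $A\mapsto\mathrm{CN}(A)$. $\mathrm{ind}(X)$ is the least $n$ such that there is a continuous $\mathbb{Z}_2$-equivariant map from $X$ to the sphere $\mathbb{S}^n$ with antipodal action. *)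

(* Defs.v *)
From HB Require Import structures.
From mathcomp Require Import all_boot all_order all_algebra.
From mathcomp Require Import all_classical all_reals all_analysis.

Set Implicit Arguments.
Unset Strict Implicit.
Unset Printing Implicit Defensive.

Import Order.TTheory GRing.Theory Num.Theory.
Import numFieldNormedType.Exports.

Local Open Scope ring_scope.

(* Closed surfaces are given by gluing squares along their sides. The square
   f has corners bd f 0, .., bd f 3 in cyclic order, labelled by vertices of
   the embedded graph, and the side (f, i) runs from bd f i to bd f (i + 1)
   (indices modulo 4). *)
Section Surfaces.
Variables (T F : finType) (bd : F -> 'Z_4 -> T).

Definition side_src (s : F * 'Z_4) : T := bd s.1 s.2.
Definition side_tgt (s : F * 'Z_4) : T := bd s.1 (s.2 + 1).
Definition side_edge (s : F * 'Z_4) : {set T} :=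
  [set side_src s; side_tgt s]%SET.

(* The edges of the link of v: u and w are the two neighbours of v on some
   face having v as a corner. *)
Definition link_rel (v : T) : rel T := fun u w =>
  [exists s : F * 'Z_4, (bd s.1 s.2 == v) &&
     ([set bd s.1 (s.2 - 1); bd s.1 (s.2 + 1)]%SET == [set u; w]%SET)].

(* The simple graph (T, e) is embedded in a closed connected surface with
   the squares as faces. Every edge belongs to exactly two sides, so every link
   is 2-regular and link_connected makes it a single cycle; thus the squares
   glued along the edges of e form a closed 2-manifold. *)
Record quadrangulation (e : rel T) : Prop := Quadrangulation {
  graph_sym : symmetric e;
  graph_irr : irreflexive e;
  graph_connected : forall x y : T, connect e x y;
  face_4cycle : forall f : F,
    injective (bd f) /\ forall i : 'Z_4, e (bd f i) (bd f (i + 1));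
  edge_two_sides : forall u v : T, e u v ->
    #|[set s | side_edge s == [set u; v]%SET]%SET| = 2%N;
  vertex_on_face : forall v : T, exists (f : F) (i : 'Z_4), bd f i = v;
  link_connected : forall v u w : T, e v u -> e v w -> connect (link_rel v) u w
}.

(* The gluing of sides obtained from the surface by cutting it along the set
   of edges C. *)
Definition glued (C : {set {set T}}) (s t : F * 'Z_4) : bool :=
  [&& s != t, side_edge s == side_edge t & side_edge s \notin C].

(* The direction of a side when f is traversed in the order of bd f
   (o f = true) or in the reverse order (o f = false). *)
Definition side_dir (o : F -> bool) (s : F * 'Z_4) : T * T :=
  if o s.1 then (side_src s, side_tgt s) else (side_tgt s, side_src s).

(* Orientability of the (possibly bordered) surface cut along C: the faces can
   be oriented so that any two sides still glued have opposite directions. *)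
Definition cut_orientable (C : {set {set T}}) : Prop :=
  exists o : F -> bool, forall s t : F * 'Z_4, glued C s t ->
    side_dir o s = swap_pair (side_dir o t).

Definition orientable : Prop := cut_orientable finset.set0.

Definition cycle_edges (p : seq T) : {set {set T}} :=
  [set [set u; next p u]%SET | u in p]%SET.

Definition odd_quadrangulation (e : rel T) : Prop :=
  quadrangulation e /\
  exists p : seq T, [/\ ucycle e p, (2 < size p)%N, odd (size p) &
    cut_orientable (cycle_edges p)].

End Surfaces.

(* A finite abstract simplicial complex with vertices in V is a set of finite
   sets of vertices; whether the empty simplex belongs to it is immaterial. *)
Section Lovasz.
Variables (T : finType) (e : rel T).

Definition CN (A : {set T}) : {set T} :=
  [set v | [forall a in A, e a v]]%SET.

Definition nbhd_complex : {set {set T}} := [set A | CN A != finset.set0]%SET.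

Definition barycentric (V : finType) (K : {set {set V}}) : {set {set {set V}}} :=
  [set S : {set {set V}} |
     [forall A in S, (A \in K) && (A != finset.set0)] &&
     [forall A in S, forall B in S, (A \subset B) || (B \subset A)]]%SET.

Definition induced_subcomplex (V : finType) (K : {set {set V}}) (W : {set V}) :
  {set {set V}} := [set S in K | S \subset W]%SET.

Definition lovasz_complex : {set {set {set T}}} :=
  induced_subcomplex (barycentric nbhd_complex) [set A | CN (CN A) == A]%SET.

End Lovasz.

Section Index.
Variable R : realType.

(* Barycentric coordinates, with the topology of R^V. *)
Definition realization (V : finType) (K : {set {set V}}) : set {ptws V -> R} :=
  [set x | [/\ forall v, 0 <= x v, \sum_v x v = 1 &
               [set v | x v != 0]%SET \in K]]%classic.

(* Affine extension of a map defined on the vertices. *)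
Definition affine_ext (V W : finType) (h : V -> W) (x : {ptws V -> R}) :
  {ptws W -> R} := fun w => \sum_(v | h v == w) x v.

Definition sphere (n : nat) : set 'rV[R]_n.+1 :=
  [set y | \sum_i y ord0 i ^+ 2 = 1]%classic.

(* f is a Z_2-map from X, with the action of nu, to the n-sphere. *)
Definition Z2_map_to_sphere (U : topologicalType) (X : set U) (nu : U -> U)
    (n : nat) (f : U -> 'rV[R]_n.+1) : Prop :=
  [/\ {within X, continuous f}%classic,
      forall x, X x -> sphere (f x) &
      forall x, X x -> f (nu x) = - f x].

(* The infimum is over a set of natural numbers, so it is attained unless this
   set is empty, when it is +oo. *)
Definition Z2_index (U : topologicalType) (X : set U) (nu : U -> U) : \bar R :=
  ereal_inf [set (n%:R)%:E | n in
    [set n : nat | exists f, @Z2_map_to_sphere U X nu n f]]%classic.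

Definition ind_lovasz (T : finType) (e : rel T) : \bar R :=
  Z2_index (realization (lovasz_complex e)) (affine_ext (CN e)).

End Index.

(* Main.v *)
Require Import Defs.
From mathcomp Require Import all_boot all_order all_algebra.
From mathcomp Require Import all_classical all_reals all_analysis.
From mathcomp Require Import ring lra zify.
Set Implicit Arguments.
Unset Strict Implicit.
Unset Printing Implicit Defensive.
Import Order.TTheory GRing.Theory Num.Theory.
Import numFieldNormedType.Exports.
Local Open Scope ring_scope.

(* A Z_2-map from L(G) to the circle assigns to every pair of comparable
   vertices A, B of L(G) an integer c(A, B), the signed number of crossings of
   the horizontal axis along the image of the segment AB. It is additive along
   chains and invariant under CN, and its parity says whether A and B have
   images in different half-circles. For an edge uw of G put
   beta(u, w) = c(CN^2{u}, CN{w}). Invariance under CN makes beta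
   antisymmetric, and inserting CN^2{a, c} between CN^2{a} and CN{b} shows that
   it sums to zero around every face abcd. Since CN exchanges the half-circles,
   beta(u, w) is odd up to a coboundary, so beta has an odd sum along the odd
   cycle C.
   Orient the faces coherently away from C. The boundary of the sum of all
   oriented faces is a cycle carried by C, hence m C for an integer m, and
   pairing with beta gives m * (odd number) = 0. So m = 0, and the orientation
   is coherent along C too: the surface is orientable. *)

(** * Face orientations and the boundary of the sum of the oriented faces *)

Section OrientedSides.
Variables (T F : finType) (bd : F -> 'Z_4 -> T) (o : F -> bool).

Lemma side_edge_dir (s : F * 'Z_4) :
  side_edge bd s = [set (side_dir bd o s).1; (side_dir bd o s).2]%SET.
Proof. by rewrite /side_edge /side_dir; case: (o s.1) => //=; rewrite finset.setUC. Qed.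

Lemma set2_eq_pair (a b c d : T) :
  ([set a; b] == [set c; d])%SET ->
  (a, b) = (c, d) \/ (a, b) = (d, c).
Proof.
move/eqP/setP => E.
have := E a; have := E b; have := E c; have := E d; rewrite !inE !eqxx !orbT /=.
move=> + + /esym/orP[]/eqP Hb /esym/orP[]/eqP Ha; rewrite Ha Hb {E}.
- by rewrite !orbb => /eqP <- _; left.
- by right.
- by left.
- by rewrite !orbb => _ /eqP <-; left.
Qed.

Definition dir_count (u v : T) : int :=
  \sum_(s : F * 'Z_4) (side_dir bd o s == (u, v))%:R.

(* The coefficient of the edge uv in the boundary of the sum of the faces. *)
Definition edge_excess (u v : T) : int := dir_count u v - dir_count v u.

Lemma edge_excessC u v : edge_excess v u = - edge_excess u v.
Proof. by rewrite /edge_excess opprB. Qed.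

(** The boundary of a face is a closed walk: each corner starts one side and ends another, so
    shifting the index by one matches the sums, and reversing a face only exchanges them. *)
Lemma sum_side_dir (phi : T -> int) :
  \sum_s phi (side_dir bd o s).1 = \sum_s phi (side_dir bd o s).2.
Proof.
rewrite -!(pair_bigA _ (fun f i => phi (side_dir bd o (f, i)).1))
        -!(pair_bigA _ (fun f i => phi (side_dir bd o (f, i)).2)) /=.
apply: eq_bigr => f _; rewrite /side_dir /=.
have E : \sum_(i : 'Z_4) phi (bd f i) = \sum_(i : 'Z_4) phi (bd f (i + 1)).
  exact: (reindex_inj (addIr 1)).
by case: (o f).
Qed.

(* The boundary of a boundary vanishes. *)
Lemma sum_edge_excess u : \sum_v edge_excess u v = 0.
Proof.
rewrite /edge_excess sumrB /dir_count exchange_big [X in _ - X]exchange_big /=.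
apply/eqP; rewrite subr_eq0; apply/eqP.
transitivity (\sum_s ((side_dir bd o s).1 == u)%:R : int).
  apply: eq_bigr => s _; case: (side_dir bd o s) => a b /=.
  rewrite (bigD1 b) //= big1 => [|v vb]; first by rewrite xpair_eqE eqxx andbT addr0.
  by rewrite xpair_eqE (eq_sym b) (negPf vb) andbF.
rewrite (sum_side_dir (fun x => (x == u)%:R)); apply/esym/eq_bigr => s _.
case: (side_dir bd o s) => a b /=.
rewrite (bigD1 a) //= big1 => [|v vb]; first by rewrite xpair_eqE eqxx addr0.
by rewrite xpair_eqE (eq_sym a) (negPf vb).
Qed.

Lemma sum_dir_count (phi : T -> T -> int) :
  \sum_u \sum_v dir_count u v * phi u v =
  \sum_s phi (side_dir bd o s).1 (side_dir bd o s).2.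
Proof.
rewrite pair_big /=.
under eq_bigr => uv _ do rewrite /dir_count mulr_suml.
rewrite exchange_big /=; apply: eq_bigr => s _.
rewrite (bigD1 (side_dir bd o s)) //= big1 => [|uv ne].
  by rewrite -surjective_pairing eqxx mul1r addr0.
by rewrite -surjective_pairing eq_sym (negPf ne) mul0r.
Qed.

Variables (e : rel T) (hq : quadrangulation bd e).

Lemma side_dir_edge s : e (side_dir bd o s).1 (side_dir bd o s).2.
Proof.
have [_ E] := face_4cycle hq s.1; have := E s.2.
by rewrite /side_dir; case: (o s.1) => //=; rewrite (graph_sym hq).
Qed.

Lemma dir_count_nedge u v : ~~ e u v -> dir_count u v = 0.
Proof.
move=> nuv; apply: big1 => s _; case: eqP => // E.
by have := side_dir_edge s; rewrite E (negPf nuv).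
Qed.

Lemma dir_count_edge s t u v : e u v -> s != t ->
  side_edge bd s = [set u; v]%SET -> side_edge bd t = [set u; v]%SET ->
  dir_count u v = (side_dir bd o s == (u, v))%:R + (side_dir bd o t == (u, v))%:R.
Proof.
move=> uv st Es Et.
have /eqP := edge_two_sides hq uv; rewrite eq_sym => /eqP c2.
have Eset : ([set s | side_edge bd s == [set u; v]] = [set s; t])%SET.
  apply/esym/eqP; rewrite eqEcard cards2 st -c2 leqnn andbT.
  by apply/fintype.subsetP => x; rewrite !inE => /orP[] /eqP ->; rewrite ?Es ?Et.
rewrite /dir_count (bigD1 s) //= (bigD1 t) //=; last by rewrite eq_sym.
rewrite big1 ?addr0 // => r /andP[rs rt]; case: eqP => // E.
have : r \in [set s | side_edge bd s == [set u; v]]%SET.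
  by rewrite inE (side_edge_dir r) E.
by rewrite Eset !inE (negPf rs) (negPf rt).
Qed.

Lemma edge_sides u v : e u v -> exists s t, [/\ s != t,
  side_edge bd s = [set u; v]%SET & side_edge bd t = [set u; v]%SET].
Proof.
move=> uv; have /eqP/cards2P[s [t [st E]]] := edge_two_sides hq uv.
exists s, t; split => //.
  by have := finset.set21 s t; rewrite -E inE => /eqP.
by have := finset.set22 s t; rewrite -E inE => /eqP.
Qed.

(** The two sides carrying an edge outside [C] are glued, so they run in opposite directions and
    cancel in the boundary. *)
Lemma edge_excess_uncut (C : {set {set T}}) u v :
  (forall s t, glued bd C s t -> side_dir bd o s = swap_pair (side_dir bd o t)) ->
  [set u; v]%SET \notin C -> edge_excess u v = 0.
Proof.
move=> ho nC; rewrite /edge_excess; have [uv|nuv] := boolP (e u v); last first.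
  by rewrite !dir_count_nedge ?subr0 // (graph_sym hq).
have vu : e v u by rewrite (graph_sym hq).
have [s [t [st Es Et]]] := edge_sides uv.
rewrite (dir_count_edge uv st Es Et) (dir_count_edge vu st);
  [|by rewrite finset.setUC..].
have -> : side_dir bd o s = swap_pair (side_dir bd o t).
  by apply: ho; rewrite /glued st Es Et eqxx.
case: (side_dir bd o t) => a b; rewrite /swap_pair !xpair_eqE /=.
by case: (a == u); case: (b == v); case: (a == v); case: (b == u).
Qed.

(** If the two sides of some edge ran in the same direction, the excess of that edge would be 2 or
    -2; hence vanishing excess makes [o] itself coherent everywhere. *)
Lemma edge_excess0_orientable : (forall u v, edge_excess u v = 0) -> orientable bd.
Proof.
move=> D0; exists o => s t /and3P[st /eqP Est _].
have := side_dir_edge s; have := side_edge_dir s; have := side_edge_dir t.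
case Es : (side_dir bd o s) => [u v]; case Et : (side_dir bd o t) => [a b] /=.
move=> Et' Es' uv; have vu : e v u by rewrite (graph_sym hq).
have /set2_eq_pair[] : ([set a; b] == [set u; v])%SET by rewrite -Et' -Es' Est.
  move=> [au bv]; have := D0 u v; rewrite /edge_excess.
  rewrite (dir_count_edge uv st) ?Es' -?Est //.
  rewrite (dir_count_edge vu st) ?Es' -?Est 1?[RHS]finset.setUC //.
  rewrite Es Et au bv eqxx xpair_eqE.
  case: (eqVneq u v) => [uv'|//]; by move: uv; rewrite uv' (graph_irr hq).
by move=> [-> ->].
Qed.

End OrientedSides.

(** * Pairing the boundary along the cut cycle with a cocycle *)

Section CutCycle.
Variables (T F : finType) (bd : F -> 'Z_4 -> T) (e : rel T) (p : seq T).
Variable beta : T -> T -> int.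
Hypotheses (hq : quadrangulation bd e) (Up : ucycle e p) (p3 : (2 < size p)%N).
Hypothesis betaC : forall u v, e u v -> beta v u = - beta u v.
Hypothesis beta_face :
  forall f, \sum_(i : 'Z_4) beta (bd f i) (bd f (i + 1)) = 0.

Let Uuniq : uniq p. Proof. by case/andP: Up. Qed.

Lemma cycle_edgesP u v : ([set u; v]%SET \in cycle_edges p) ->
  (u \in p /\ v = next p u) \/ (v \in p /\ u = next p v).
Proof.
case/imsetP => x xp /eqP/set2_eq_pair[[-> ->]|[-> ->]]; by [left|right].
Qed.

(** Rotate [p] to start at [u]: as it has at least three entries, the second successor of [u] is the
    third entry, which differs from [u]. Thus the two cycle edges at [u] are distinct and contribute
    separately to sums over neighbours. *)
Lemma next_neq_prev u : u \in p -> next p u != prev p u.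
Proof.
move=> up; apply/eqP => E.
have : next p (next p u) = u by rewrite E next_prev.
have [i q Eq] := rot_to up; rewrite -!(next_rot i Uuniq) Eq.
have := Uuniq; rewrite -(rot_uniq i) Eq; move: p3; rewrite -(size_rot i) Eq.
case: q {Eq} => [//|a [//|b q]] _ /=.
rewrite !inE !negb_or => /andP[/and3P[ua ub _] _].
by rewrite eqxx (eq_sym a) (negPf ua) eqxx => bu; rewrite bu eqxx in ub.
Qed.

Lemma cocycle_orientable :
  cut_orientable bd (cycle_edges p) ->
  \sum_(u in p) beta u (next p u) != 0 -> orientable bd.
Proof.
case=> o ho bn0; set D := edge_excess bd o.
have Dout u v : [set u; v]%SET \notin cycle_edges p -> D u v = 0.
  exact: (edge_excess_uncut hq).
(* Conservation at [u]: only the two edges of [p] at [u] contribute to the vanishing total excess,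
   so inflow equals outflow. *)
have Dp u : u \in p -> D u (next p u) = D (prev p u) u.
  move=> up; have := sum_edge_excess bd o u.
  rewrite (bigD1 (next p u)) //= (bigD1 (prev p u)) /=; last first.
    by rewrite eq_sym next_neq_prev.
  rewrite big1 => [|v /andP[vn vp]].
    by rewrite addr0 -/D [D u (prev _ _)]edge_excessC => /eqP; rewrite subr_eq0 => /eqP.
  apply: Dout; apply/negP => /cycle_edgesP[[_ E]|[_ E]].
    by rewrite E eqxx in vn.
  by rewrite E prev_next ?eqxx in vp.
have [x0 x0p] : exists x0, x0 \in p by case: (p) p3 => // a q _; exists a; rewrite inE eqxx.
pose m := D x0 (next p x0).
have Dm u : u \in p -> D u (next p u) = m.
  rewrite -(fconnect_cycle (cycle_next Uuniq) x0p) => /iter_findex <-.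
  elim: (findex _ _ _) => [//|n IH]; rewrite iterS.
  rewrite Dp; first by rewrite prev_next.
  rewrite mem_next; elim: n {IH} => [//|n IH]; by rewrite iterS mem_next.
suff m0 : m = 0.
  apply: (edge_excess0_orientable (o := o) hq) => u v.
  have [/cycle_edgesP[[up ->]|[vp ->]]|/Dout //] :=
    boolP ([set u; v]%SET \in cycle_edges p).
    by have := Dm _ up; rewrite m0.
  by have := Dm _ vp; rewrite m0 edge_excessC /D => ->; rewrite oppr0.
(* This pairs [beta] with the sum of the oriented faces; reversing a face only changes the sign of
   its contribution, which is zero by [beta_face]. *)
have S0 : \sum_u \sum_v dir_count bd o u v * beta u v = 0.
  rewrite sum_dir_count.
  rewrite -(pair_bigA _ (fun f i => beta (side_dir bd o (f, i)).1 (side_dir bd o (f, i)).2)) /=.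
  apply: big1 => f _; rewrite /side_dir /=; case: (o f) => /=; first exact: beta_face.
  have [_ ef] := face_4cycle hq f.
  under eq_bigr => i _ do rewrite (betaC (ef i)).
  by rewrite sumrN beta_face oppr0.
have S1 : \sum_u \sum_v D u v * beta u v = 0.
  transitivity (\sum_u \sum_v (dir_count bd o u v * beta u v + dir_count bd o v u * beta v u)).
    apply: eq_bigr => u _; apply: eq_bigr => v _; rewrite /D /edge_excess.
    have [uv|nuv] := boolP (e u v); first by rewrite (betaC uv); ring.
    rewrite !(dir_count_nedge o hq) // 1?(graph_sym hq) //; ring.
  under eq_bigr => u _ do rewrite big_split /=.
  by rewrite big_split /= S0 exchange_big /= S0.
(* The factor 2 arises because each edge of [p] is met in both directions, and reversal changes the
   sign of both [D] and [beta]. *)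
have S2 : \sum_u \sum_v D u v * beta u v = 2 * m * \sum_(u in p) beta u (next p u).
  transitivity (\sum_(u in p) (D u (next p u) * beta u (next p u)
                  + D u (prev p u) * beta u (prev p u))).
    rewrite [RHS]big_mkcond /=; apply: eq_bigr => u _; case: ifP => up.
      rewrite (bigD1 (next p u)) //= (bigD1 (prev p u)) /=; last first.
        by rewrite eq_sym next_neq_prev.
      rewrite big1 ?addr0 // => v /andP[vn vp]; rewrite Dout ?mul0r //.
      apply/negP => /cycle_edgesP[[_ E]|[_ E]]; first by rewrite E eqxx in vn.
      by rewrite E prev_next ?eqxx in vp.
    apply: big1 => v _; rewrite Dout ?mul0r //.
    apply/negP => /cycle_edgesP[[up' _]|[vp E]]; first by rewrite up' in up.
    by rewrite E mem_next vp in up.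
  rewrite big_split /= [X in _ + X](_ : _ = m * \sum_(u in p) beta u (next p u)).
    rewrite (eq_bigr (fun u => m * beta u (next p u))) => [|u up]; last by rewrite Dm.
    by rewrite -mulr_sumr; ring.
  rewrite (reindex_inj (can_inj (prev_next Uuniq))) /= mulr_sumr.
  apply: eq_big => [u|u]; first by rewrite mem_next.
  rewrite mem_next => up; rewrite prev_next //.
  have -> : D (next p u) u = - m by rewrite -(Dm u up) -edge_excessC.
  rewrite betaC; first ring.
  by case/andP: Up => /next_cycle /(_ up).
move/eqP: S1; rewrite S2 !mulf_eq0 (negPf bn0) orbF /= => /eqP //.
Qed.

End CutCycle.

(** * Signed crossings of discrete paths on the circle *)

Lemma addrr_F2 (a : 'F_2) : a + a = 0.
Proof. by case: a => -[|[|//]] i; apply/val_inj. Qed.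

Section Crossing.
Variable R : realType.
Implicit Types x y z : R * R.

Definition on_circle x : Prop := x.1 ^+ 2 + x.2 ^+ 2 = 1.

Definition near4 x y : Prop := `|x.1 - y.1| < 4^-1 /\ `|x.2 - y.2| < 4^-1.

(** The half-circle contains (1, 0) but not (-1, 0), so that the antipodal map exchanges it exactly
    with its complement in the circle. *)
Definition upper x : bool := (0 < x.2) || ((x.2 == 0) && (0 < x.1)).

(* The sign is read off x.1 alone: when x and y are close on the circle and in
   different half-circles, both are near the same point (1, 0) or (-1, 0). *)
Definition crossing x y : int :=
  ((upper y)%:R - (upper x)%:R) * (if 0 < x.1 then 1 else -1).

Lemma upperN x : on_circle x -> upper (- x) = ~~ upper x.
Proof.
case: x => a b; rewrite /on_circle /upper /= oppr_gt0 oppr_eq0 oppr_gt0.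
case: (ltgtP b 0) => //= -> c1; case: (ltgtP a 0) => // a0.
by move/eqP: c1; rewrite a0 expr0n addr0 eq_sym oner_eq0.
Qed.

(** Changing half-circle within distance 1/4 forces [x.2] below 1/4 in absolute value. Then [x.1]
    exceeds 1/4 in absolute value, and a move of less than 1/4 cannot change its sign. *)
Lemma near4_same_sign x y z : on_circle x -> on_circle y ->
  near4 x y -> near4 x z -> upper x != upper y ->
  (0 < x.1) = (0 < z.1) /\ x.1 != 0.
Proof.
case: x y z => [a b] [c d] [a' b'].
rewrite /on_circle /near4 /upper /= => cx cy [ac bd] [aa' _] ne.
have hb : - 4^-1 < b < 4^-1.
  move: bd ne; rewrite ltr_norml => /andP[h1 h2].
  case: (ltgtP b 0) => hb; case: (ltgtP d 0) => hd //= _; lra.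
have ha : 4^-1 < `|a|.
  have a2 : a ^+ 2 = `|a| ^+ 2 by rewrite real_normK // num_real.
  rewrite ltNge; apply/negP => h; have := normr_ge0 a; nra.
move: ha aa'; rewrite ltr_norml; case: (ltrgt0P a) => [a0|a0|->] h /andP[h1 h2].
- by split => //; have -> : 0 < a' by lra.
- by split => //; apply/esym/negbTE; rewrite -leNgt; lra.
- lra.
Qed.

Definition near4_circle x y : Prop := [/\ on_circle x, on_circle y & near4 x y].

Lemma near4C x y : near4 x y -> near4 y x.
Proof. by case=> a b; split; rewrite distrC. Qed.

(** If any half-circle change occurs, the sign factors of the terms that matter agree by
    [near4_same_sign], and the differences of [upper] telescope. *)
Lemma crossing_trans x y z : near4_circle x y -> near4_circle y z ->
  near4_circle x z -> crossing x y + crossing y z = crossing x z.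
Proof.
move=> [cx cy xy] [_ cz yz] [_ _ xz]; rewrite /crossing.
have [Exy|nxy] := eqVneq (upper x) (upper y).
  have [Eyz|nyz] := eqVneq (upper y) (upper z).
    by rewrite Exy Eyz !subrr !mul0r addr0.
  have [-> _] := near4_same_sign cy cz yz (near4C xy) nyz.
  by rewrite Exy subrr mul0r add0r.
have [-> _] := near4_same_sign cx cy xy xy nxy.
ring.
Qed.

Lemma crossingxx x : crossing x x = 0.
Proof. by rewrite /crossing subrr mul0r. Qed.

Lemma crossingC x y : near4_circle x y -> crossing y x = - crossing x y.
Proof.
move=> [cx cy xy]; rewrite /crossing.
have [->|nxy] := eqVneq (upper x) (upper y); first by rewrite subrr !mul0r oppr0.
have [-> _] := near4_same_sign cx cy xy xy nxy; ring.
Qed.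

(** The antipodal map reverses both the change of half-circle and the sign of the first coordinate,
    so the product is unchanged. *)
Lemma crossingN x y : near4_circle x y -> crossing (- x) (- y) = crossing x y.
Proof.
move=> [cx cy xy]; rewrite /crossing !upperN //.
have [->|nxy] := eqVneq (upper x) (upper y); first by rewrite !subrr !mul0r.
have [_ x0] := near4_same_sign cx cy xy xy nxy; rewrite /= oppr_gt0.
by move: x0 nxy; case: (ltrgt0P x.1) => // _ _; case: (upper x); case: (upper y).
Qed.

Lemma crossing_mod2 x y :
  (crossing x y)%:~R = (upper x)%:R + (upper y)%:R :> 'F_2.
Proof.
by rewrite /crossing; case: (upper x); case: (upper y); case: ifP => _; apply/val_inj.
Qed.

(** For paths with small steps this counts half-turns: a full counterclockwise turn crosses the axis
    at (1, 0) and at (-1, 0), each with sign +1, and contributes 2. *)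
Definition winding (N : nat) (x : nat -> R * R) : int :=
  \sum_(k < N) crossing (x k) (x k.+1).

Lemma winding_mod2 N (x : nat -> R * R) :
  (winding N x)%:~R = (upper (x 0%N))%:R + (upper (x N))%:R :> 'F_2.
Proof.
rewrite /winding; elim: N => [|N IH]; first by rewrite big_ord0 addrr_F2.
rewrite big_ord_recr /= intrD IH crossing_mod2.
by rewrite -addrA [X in _ + X]addrA addrr_F2 add0r.
Qed.

(** The strip between the two paths is cut into squares, each split by the diagonal from [x k] to
    [y k.+1]; [crossing_trans] applies to both triangles. *)
Lemma winding_homotopy N (x y : nat -> R * R) :
  (forall k l, (k <= N)%N -> (l <= N)%N -> (k <= l.+1)%N -> (l <= k.+1)%N ->
     [/\ near4_circle (x k) (x l), near4_circle (x k) (y l)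
       & near4_circle (y k) (y l)]) ->
  winding N x + crossing (x N) (y N) = crossing (x 0%N) (y 0%N) + winding N y.
Proof.
rewrite /winding; elim: N => [|N IH] H; first by rewrite !big_ord0 addrC.
rewrite !big_ord_recr /= addrA -IH => [|k l kN lN]; last by apply: H; lia.
rewrite -!addrA; congr (_ + _).
have [xx _ _] := H N N.+1 ltac:(lia) ltac:(lia) ltac:(lia) ltac:(lia).
have [_ xy _] := H N.+1 N.+1 ltac:(lia) ltac:(lia) ltac:(lia) ltac:(lia).
have [_ xy' _] := H N N ltac:(lia) ltac:(lia) ltac:(lia) ltac:(lia).
have [_ xy1 yy] := H N N.+1 ltac:(lia) ltac:(lia) ltac:(lia) ltac:(lia).
by rewrite (crossing_trans xx xy xy1) (crossing_trans xy' yy xy1).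
Qed.

(* Rows of the grid are successive paths issuing from a common point, so the
   winding of the right column measures their total change. *)
Lemma winding_grid N (G : nat -> nat -> R * R) :
  (forall j i k l, [/\ (j <= N)%N, (i <= N)%N, (k <= N)%N & (l <= N)%N] ->
     (j <= i.+1)%N -> (i <= j.+1)%N -> (k <= l.+1)%N -> (l <= k.+1)%N ->
     near4_circle (G j k) (G i l)) ->
  (forall j, (j <= N)%N -> G j 0%N = G 0%N 0%N) ->
  winding N (G 0%N) + winding N (fun j => G j N) = winding N (G N).
Proof.
move=> H H0.
suff E M : (M <= N)%N ->
    winding N (G 0%N) + winding M (fun j => G j N) = winding N (G M).
  exact: E.
elim: M => [|M IH] MN; first by rewrite {2}/winding big_ord0 addr0.
rewrite {2}/winding big_ord_recr /= addrA IH ?(ltnW MN) //.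
rewrite (winding_homotopy (y := G M.+1)); last first.
  by move=> k l kN lN kl lk; split; apply: H; by [split; lia|lia].
by rewrite (H0 M.+1) // (H0 M) ?(ltnW MN) // crossingxx add0r.
Qed.

Lemma winding_rev N (x y : nat -> R * R) :
  (forall k, (k < N)%N -> near4_circle (x k) (x k.+1)) ->
  (forall k, (k <= N)%N -> y k = x (N - k)%N) ->
  winding N y = - winding N x.
Proof.
move=> H E; rewrite /winding (reindex_inj rev_ord_inj) /= -sumrN.
apply: eq_bigr => k _; have kN := ltn_ord k; rewrite !E ?leq_subr //; last by lia.
rewrite subKn // (_ : (N - (N - k.+1).+1)%N = k); last by lia.
by rewrite crossingC //; apply: H.
Qed.

Lemma windingN N (x y : nat -> R * R) :
  (forall k, (k < N)%N -> near4_circle (x k) (x k.+1)) ->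
  (forall k, (k <= N)%N -> y k = - x k) ->
  winding N y = winding N x.
Proof.
move=> H E; apply: eq_bigr => k _; rewrite !E ?(ltnW (ltn_ord k)) //.
by rewrite crossingN //; apply: H.
Qed.

End Crossing.

(** * Parametrized simplices of a realization and uniform continuity on them *)

Lemma ptws_continuous (S U : topologicalType) (I : Type) (phi : S -> {ptws I -> U}) :
  (forall i, continuous (fun x => phi x i)) -> continuous phi.
Proof.
move=> c x; apply/cvg_sup => i; move: x.
apply/(@continuousP _ (initial_topology (@^~ i))) => A [B oB <-].
by apply: (open_comp (f := fun x => phi x i)) => // y _; exact: c.
Qed.

Section Simplices.
Variables (R : realType) (V : finType).

Definition seg (A B : V) (s : R) : {ptws V -> R} :=
  fun v => (1 - s) * (v == A)%:R + s * (v == B)%:R.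

(* The triangle ABC as a cone with apex A (at s = 0) over the segment BC. *)
Definition tri (A B C : V) (s t : R) : {ptws V -> R} :=
  fun v => (1 - s) * (v == A)%:R + s * ((1 - t) * (v == B)%:R + t * (v == C)%:R).

Lemma tri_s0 A B C s : tri A B C s 0 = seg A B s.
Proof. by apply/funext => v; rewrite /tri /seg; ring. Qed.

Lemma tri_s1 A B C s : tri A B C s 1 = seg A C s.
Proof. by apply/funext => v; rewrite /tri /seg; ring. Qed.

Lemma tri_1t A B C t : tri A B C 1 t = seg B C t.
Proof. by apply/funext => v; rewrite /tri /seg; ring. Qed.

Lemma tri_0t A B C t : tri A B C 0 t = seg A A 0.
Proof. by apply/funext => v; rewrite /tri /seg; ring. Qed.

Lemma seg0 A B : seg A B 0 = seg A A 0.
Proof. by apply/funext => v; rewrite /seg; ring. Qed.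

Lemma seg1 A B : seg A B 1 = seg B B 0.
Proof. by apply/funext => v; rewrite /seg; ring. Qed.

Lemma segC A B s : seg A B (1 - s) = seg B A s.
Proof. by apply/funext => v; rewrite /seg; ring. Qed.

Lemma affine_ext_seg (W : finType) (h : V -> W) A B s :
  affine_ext h (seg A B s) = (fun w => (1 - s) * (w == h A)%:R + s * (w == h B)%:R).
Proof.
apply/funext => w; rewrite /affine_ext /seg big_split /= -!mulr_sumr.
have E D : \sum_(v | h v == w) (v == D)%:R = (w == h D)%:R :> R.
  rewrite big_mkcond (bigD1 D) //= eqxx big1 ?addr0 ?(eq_sym w); first by case: ifP.
  by move=> v /negPf ->; rewrite if_same.
by rewrite !E.
Qed.

Lemma tri_continuous A B C : continuous (fun z : R * R => tri A B C z.1 z.2).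
Proof.
apply: ptws_continuous => v z; rewrite /tri.
have c1 : continuous (fun z : R * R => z.1) by move=> u; exact: cvg_fst.
have c2 : continuous (fun z : R * R => z.2) by move=> u; exact: cvg_snd.
apply: cvgD; first by apply: cvgMl; apply: cvgB; [exact: cvg_cst|exact: c1].
apply: cvgM; first exact: c1.
apply: cvgD; apply: cvgMl; last exact: c2.
by apply: cvgB; [exact: cvg_cst|exact: c2].
Qed.

Definition in_unit (s : R) : bool := 0 <= s <= 1.

Variable K : {set {set V}}.

(** Repetitions are allowed: [spans A B B] covers edges and [spans A A A] vertices, so one
    parametrization [tri] serves simplices of every dimension up to 2. *)
Definition spans (A B C : V) : Prop :=
  forall S : {set V}, S \subset [set A; B; C]%SET -> S \in K.

Lemma tri_realization A B C s t : spans A B C -> in_unit s -> in_unit t ->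
  @realization R V K (tri A B C s t).
Proof.
move=> hK /andP[s0 s1] /andP[t0 t1]; split.
- move=> v; rewrite /tri; have := ler0n R (v == A); have := ler0n R (v == B).
  have := ler0n R (v == C) => c0 b0 a0.
  have s0' : 0 <= 1 - s by rewrite subr_ge0.
  have t0' : 0 <= 1 - t by rewrite subr_ge0.
  apply: addr_ge0; first exact: mulr_ge0.
  by apply: mulr_ge0 => //; apply: addr_ge0; exact: mulr_ge0.
- have E D : \sum_(v : V) (v == D)%:R = 1 :> R.
    rewrite (bigD1 D) //= eqxx big1 ?addr0 // => v /negPf -> //.
  by rewrite /tri big_split /= -!mulr_sumr big_split /= -!mulr_sumr !E; ring.
- apply: hK; apply/fintype.subsetP => v; rewrite !inE; apply: contraR.
  rewrite !negb_or -andbA => /and3P[/negPf a /negPf b /negPf c].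
  by rewrite /tri a b c !(mulr0, addr0).
Qed.

(** Heine-Cantor on the compact unit square of parameters. Stating it for all large [n] lets
    finitely many such conditions be met by one [n]. *)
Lemma tri_modulus (g : {ptws V -> R} -> R) A B C :
  {within @realization R V K, continuous g}%classic -> spans A B C ->
  \forall n \near \oo%classic, forall s t s' t',
    in_unit s -> in_unit t -> in_unit s' -> in_unit t' ->
    `|s - s'| <= n.+1%:R^-1 -> `|t - t'| <= n.+1%:R^-1 ->
    `|g (tri A B C s t) - g (tri A B C s' t')| < 4^-1.
Proof.
move=> /subspace_continuousP cg hK.
pose Q : set (R * R) := (`[0, 1] `*` `[0, 1])%classic.
have QE z : Q z <-> in_unit z.1 /\ in_unit z.2.
  by rewrite /Q /= !in_itv.
have cQ : compact Q by apply: compact_setX; exact: segment_compact.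
pose P n (z : R * R) := forall z', Q z' ->
  `|z.1 - z'.1| <= n.+1%:R^-1 -> `|z.2 - z'.2| <= n.+1%:R^-1 ->
    `|g (tri A B C z.1 z.2) - g (tri A B C z'.1 z'.2)| < 4^-1.
suff : \forall n \near \oo%classic, (Q `<=` P n)%classic.
  apply: filterS => n H s t s' t' hs ht hs' ht'.
  by apply: (H (s, t) _ (s', t')); apply/QE.
move/compact_near_coveringP/near_covering_withinP : cQ; apply => z Qz.
have /QE[z1 z2] := Qz.
have /cvgrPdist_lt := cg _ (tri_realization hK z1 z2).
(* Half of the tolerance 1/4, since two nearby values are compared through the value at [z]. *)
have p8 : (0 : R) < 8^-1 by rewrite invr_gt0.
move=> /(_ _ p8) N.
have {N} : nbhs z (fun y => Q y -> `|g (tri A B C z.1 z.2) - g (tri A B C y.1 y.2)| < 8^-1).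
  have M : nbhs z (fun y => realization K (tri A B C y.1 y.2) ->
      `|g (tri A B C z.1 z.2) - g (tri A B C y.1 y.2)| < 8^-1).
    exact: (@tri_continuous A B C z _ N).
  apply: filterS M => y Hy /QE[y1 y2].
  by apply: Hy; apply: tri_realization.
move=> /nbhs_ballP[r /= r0 Hr].
have r20 : 0 < r / 2 by rewrite divr_gt0.
(* With [z'] within [r / 2] of [z] and mesh below [r / 2], both [z'] and [y] lie in the ball of
   radius [r] around [z]. *)
exists (ball z (r / 2), [set n : nat | n.+1%:R^-1 < r / 2]%classic).
  split; first exact: nbhsx_ballx.
  exact: (near_infty_natSinv_lt (PosNum r20)).
case=> z' n /= [[b1 b2] nr] Qz' y Qy d1 d2.
have {}b1 : `|z.1 - z'.1| < r / 2 by [].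
have {}b2 : `|z.2 - z'.2| < r / 2 by [].
have {}nr : n.+1%:R^-1 < r / 2 by [].
have yz' : (ball z r) y /\ (ball z r) z'.
  split; split; rewrite /ball /=.
  - rewrite -(subrKA z'.1); apply: (le_lt_trans (ler_normD _ _)).
    by rewrite (splitr r) ltrD //; exact: le_lt_trans d1 nr.
  - rewrite -(subrKA z'.2); apply: (le_lt_trans (ler_normD _ _)).
    by rewrite (splitr r) ltrD //; exact: le_lt_trans d2 nr.
  - by apply: (lt_trans b1); rewrite ltr_pdivrMr // ltr_pMr // ltr1n.
  - by apply: (lt_trans b2); rewrite ltr_pdivrMr // ltr_pMr // ltr1n.
have := Hr _ yz'.1 Qy; have := Hr _ yz'.2 Qz' => e1 e2.
rewrite -(subrKA (g (tri A B C z.1 z.2))).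
apply: (le_lt_trans (ler_normD _ _)); rewrite [X in X + _]distrC.
have -> : 4^-1 = 8^-1 + 8^-1 :> R by field.
exact: ltrD.
Qed.
End Simplices.

(** * The integer cocycle of an equivariant map to the circle *)

Section CircleMap.
Variables (R : realType) (V : finType) (K : {set {set V}}).
Variables (g1 g2 : {ptws V -> R} -> R) (h : V -> V).
Hypothesis cg1 : {within @realization R V K, continuous g1}%classic.
Hypothesis cg2 : {within @realization R V K, continuous g2}%classic.
Hypothesis g_circle : forall x, realization K x -> on_circle (g1 x, g2 x).
Hypothesis g_odd : forall x, realization K x ->
  g1 (affine_ext h x) = - g1 x /\ g2 (affine_ext h x) = - g2 x.

Let G x : R * R := (g1 x, g2 x).

Lemma exists_grid : exists n : nat, forall A B C, spans K A B C ->
  forall s t s' t' : R, in_unit s -> in_unit t -> in_unit s' -> in_unit t' ->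
    `|s - s'| <= n.+1%:R^-1 -> `|t - t'| <= n.+1%:R^-1 ->
    near4 (G (tri A B C s t)) (G (tri A B C s' t')).
Proof.
pose P (ABC : V * V * V) (n : nat) := spans K ABC.1.1 ABC.1.2 ABC.2 ->
  forall s t s' t' : R, in_unit s -> in_unit t -> in_unit s' -> in_unit t' ->
    `|s - s'| <= n.+1%:R^-1 -> `|t - t'| <= n.+1%:R^-1 ->
    near4 (G (tri ABC.1.1 ABC.1.2 ABC.2 s t)) (G (tri ABC.1.1 ABC.1.2 ABC.2 s' t')).
have : \forall n \near \oo%classic, forall ABC, P ABC n.
  apply: filter_forall => -[[A B] C].
  have [sp|nsp] := pselect (spans K A B C); last by apply: nearW => n /nsp.
  have m1 := tri_modulus cg1 sp; have m2 := tri_modulus cg2 sp.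
  apply: filterS2 m1 m2 => n m1 m2 _ s t s' t' hs ht hs' ht' ds dt.
  by split; [exact: m1|exact: m2].
by move=> /filter_ex[n Pn]; exists n => A B C; exact: (Pn (A, B, C)).
Qed.

(** Take for [c A B] the winding of the image of the segment AB sampled on a fine grid, and for
    [up A] the half-circle containing the image of the vertex A. Additivity holds because a map
    extending over a triangle has no winding around its boundary. *)
Lemma circle_map_cocycle : exists (c : V -> V -> int) (up : V -> bool),
  [/\ forall A B C, spans K A B C -> c A B + c B C = c A C,
      forall A B, spans K A B B -> c B A = - c A B,
      forall A B, spans K A B B -> c (h A) (h B) = c A B,
      forall A B, (c A B)%:~R = (up A)%:R + (up B)%:R :> 'F_2 &
      forall A, spans K A A A -> up (h A) = ~~ up A].
Proof.
have [n Hn] := exists_grid; pose N := n.+1.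
pose q (k : nat) : R := k%:R / N%:R.
have N0 : (0 : R) < N%:R by rewrite ltr0n.
have q0 : q 0%N = 0 by rewrite /q mul0r.
have qN : q N = 1 by rewrite /q divff // lt0r_neq0.
have q_unit k : (k <= N)%N -> in_unit (q k).
  by move=> kN; rewrite /in_unit /q divr_ge0 ?ler0n //= ler_pdivrMr // mul1r ler_nat.
have q_near k l : (k <= l.+1)%N -> (l <= k.+1)%N -> `|q k - q l| <= N%:R^-1.
  move=> kl lk; rewrite /q -mulrBl normrM [X in _ * X]ger0_norm ?invr_ge0 ?ler0n //.
  rewrite ler_piMl ?invr_ge0 ?ler0n // ler_norml.
  have k1 : k%:R <= l%:R + 1 :> R by rewrite natr1 ler_nat.
  have l1 : l%:R <= k%:R + 1 :> R by rewrite natr1 ler_nat.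
  by apply/andP; split; lra.
have tri_near A B C : spans K A B C -> forall j i k l,
    [/\ (j <= N)%N, (i <= N)%N, (k <= N)%N & (l <= N)%N] ->
    (j <= i.+1)%N -> (i <= j.+1)%N -> (k <= l.+1)%N -> (l <= k.+1)%N ->
    near4_circle (G (tri A B C (q k) (q j))) (G (tri A B C (q l) (q i))).
  move=> sp j i k l [jN iN kN lN] ji ij kl lk; split.
  - by apply: g_circle; apply: tri_realization; rewrite ?q_unit.
  - by apply: g_circle; apply: tri_realization; rewrite ?q_unit.
  - by apply: Hn; rewrite ?q_unit ?q_near.
pose gam A B k := G (seg A B (q k)).
have gam_near A B : spans K A B B -> forall k, (k < N)%N ->
    near4_circle (gam A B k) (gam A B k.+1).
  move=> sp k kN; rewrite /gam -!(tri_s0 _ _ B) -q0.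
  by apply: tri_near => //; by [split => //; exact: ltnW|lia].
have seg_real A B k : spans K A B B -> (k <= N)%N ->
    @realization R V K (seg A B (q k)).
  move=> sp kN; rewrite -(tri_s0 _ _ B) -q0; apply: tri_realization => //.
    exact: q_unit.
  by rewrite q0 /in_unit lexx ler01.
exists (fun A B => winding N (gam A B)), (fun A => upper (G (seg A A 0))); split.
(* Row [j] runs from A to the [j]-th point of BC: the bottom row is AB, the top row AC, the right
   column BC, and the left column collapses to A. *)
- move=> A B C sp; pose Gr j k := G (tri A B C (q k) (q j)).
  have <- : Gr 0%N = gam A B by apply/funext => k; rewrite /Gr /gam q0 tri_s0.
  have <- : Gr N = gam A C by apply/funext => k; rewrite /Gr /gam qN tri_s1.
  have <- : (fun j => Gr j N) = gam B C.
    by apply/funext => k; rewrite /Gr /gam qN tri_1t.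
  apply: winding_grid; first exact: tri_near.
  by move=> j _; rewrite /Gr q0 !tri_0t.
- move=> A B sp; apply: winding_rev; first exact: gam_near.
  move=> k kN; rewrite /gam -segC; congr (G (seg _ _ _)).
  by rewrite /q natrB // mulrBl divff // lt0r_neq0.
- move=> A B sp; apply: windingN; first exact: gam_near.
  move=> k kN; rewrite /gam /G.
  have -> : seg (h A) (h B) (q k) = affine_ext h (seg A B (q k)).
    by rewrite affine_ext_seg.
  by have [-> ->] := g_odd (seg_real _ _ _ sp kN).
- by move=> A B; rewrite winding_mod2 /gam q0 qN seg0 seg1.
- move=> A sp; rewrite /G.
  have -> : seg (h A) (h A) 0 = affine_ext h (seg A A 0) :> {ptws V -> R}.
    by rewrite affine_ext_seg.
  have X := seg_real A A 0%N sp isT; rewrite q0 in X.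
  have [-> ->] := g_odd X; rewrite -upperN //; exact: g_circle.
Qed.

End CircleMap.

(** * Closed sets of vertices and the simplices of the Lovász complex *)

Section CommonNeighbors.
Variables (T : finType) (e : rel T).
Hypothesis e_sym : symmetric e.
Implicit Types (A B C : {set T}) (u v w : T).

Lemma CNS A B : A \subset B -> CN e B \subset CN e A.
Proof.
move=> AB; apply/fintype.subsetP => v; rewrite !inE => /forallP H; apply/forallP => a.
by apply/implyP => /(fintype.subsetP AB) aB; have /implyP := H a; apply.
Qed.

(** Both inclusions say that every element of A is adjacent to every element of B. So [CN] forms an
    antitone Galois connection with itself. *)
Lemma sub_CN A B : (A \subset CN e B) = (B \subset CN e A).
Proof.
suff S C D : C \subset CN e D -> D \subset CN e C by apply/idP/idP; exact: S.
move=> /fintype.subsetP CD; apply/fintype.subsetP => d dD.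
rewrite inE; apply/forallP => c; apply/implyP => /CD.
by rewrite inE => /forallP/(_ d)/implyP/(_ dD); rewrite e_sym.
Qed.

Lemma sub_CNCN A : A \subset CN e (CN e A).
Proof. by rewrite sub_CN. Qed.

Lemma CNCNS A B : A \subset B -> CN e (CN e A) \subset CN e (CN e B).
Proof. by move=> AB; do 2!apply: CNS. Qed.

Lemma CN3 A : CN e (CN e (CN e A)) = CN e A.
Proof. by apply/eqP; rewrite finset.eqEsubset CNS ?sub_CNCN. Qed.

Lemma in_CN1 u v : (v \in CN e [set u]%SET) = e u v.
Proof.
rewrite inE; apply/forallP/idP => [/(_ u)|uv x]; first by rewrite !inE eqxx.
by apply/implyP; rewrite !inE => /eqP ->.
Qed.

Definition lovasz_vertex A : bool :=
  [&& A != finset.set0, CN e A != finset.set0 & CN e (CN e A) == A].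

Lemma lovasz_vertex_CN A :
  A != finset.set0 -> CN e A != finset.set0 -> lovasz_vertex (CN e A).
Proof.
move=> A0 cA0; rewrite /lovasz_vertex cA0 CN3 eqxx andbT /=.
by apply: contraNneq A0 => c0; rewrite -finset.subset0 -c0 sub_CNCN.
Qed.

Lemma lovasz_vertex_CNCN A :
  A != finset.set0 -> CN e A != finset.set0 -> lovasz_vertex (CN e (CN e A)).
Proof.
move=> A0 cA0; have /and3P[_ c2 _] := lovasz_vertex_CN A0 cA0.
exact: lovasz_vertex_CN.
Qed.

Lemma spans_lovasz A B C : lovasz_vertex A -> lovasz_vertex B -> lovasz_vertex C ->
  A \subset B -> B \subset C -> spans (lovasz_complex e) A B C.
Proof.
move=> vA vB vC AB BC S SABC; have AC := fintype.subset_trans AB BC.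
have inS X : X \in S -> [\/ X = A, X = B | X = C].
  by move=> /(fintype.subsetP SABC); rewrite !inE -orbA => /or3P[] /eqP ->; constructor.
have vS X : X \in S -> lovasz_vertex X by move=> /inS[] ->.
rewrite !inE; apply/andP; split; last first.
  by apply/fintype.subsetP => X /vS /and3P[_ _]; rewrite inE.
apply/andP; split; apply/forallP => X; apply/implyP => XS.
  by have /and3P[X0 cX0 _] := vS X XS; rewrite inE cX0 X0.
apply/forallP => Y; apply/implyP => YS.
by case: (inS X XS) => ->; case: (inS Y YS) => ->;
  rewrite ?fintype.subxx ?AB ?BC ?AC ?orbT.
Qed.

End CommonNeighbors.

(** * The cocycle of an odd quadrangulation and the index bound *)

Lemma sum_Z4 (phi : 'Z_4 -> int) :
  \sum_i phi i = phi 0 + phi 1 + phi 2%:R + phi 3%:R.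
Proof.
rewrite !big_ord_recl big_ord0 addr0 !addrA.
by congr (_ + _ + _ + _); congr phi; apply/val_inj.
Qed.

(** The map is given by two real coordinate functions so that targets of dimension 0 and 1 are
    excluded together. *)
Lemma no_circle_map (R : realType) (T F : finType) (e : rel T)
    (bd : F -> 'Z_4 -> T) (g1 g2 : {ptws {set T} -> R} -> R) :
  odd_quadrangulation bd e -> ~ orientable bd ->
  {within @realization R _ (lovasz_complex e), continuous g1}%classic ->
  {within @realization R _ (lovasz_complex e), continuous g2}%classic ->
  (forall x, realization (lovasz_complex e) x -> on_circle (g1 x, g2 x)) ->
  (forall x, realization (lovasz_complex e) x ->
     g1 (affine_ext (CN e) x) = - g1 x /\ g2 (affine_ext (CN e) x) = - g2 x) ->
  False.
Proof.
move=> [hq [p [Up p3 oddp cutp]]] nor cg1 cg2 gc go.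
have [c [up [c_trans cC c_CN c_mod2 up_CN]]] := circle_map_cocycle cg1 cg2 gc go.
have es := graph_sym hq.
pose Nb u := CN e [set u]%SET; pose cl u := CN e (Nb u).
have vx (A : {set T}) x y : x \in A -> y \in CN e A ->
    lovasz_vertex e (CN e A) /\ lovasz_vertex e (CN e (CN e A)).
  move=> xA yA.
  have A0 : A != finset.set0 by apply/finset.set0Pn; exists x.
  have cA0 : CN e A != finset.set0 by apply/finset.set0Pn; exists y.
  by split; [exact: lovasz_vertex_CN|exact: lovasz_vertex_CNCN].
have vx1 u w : e u w -> lovasz_vertex e (Nb u) /\ lovasz_vertex e (cl u).
  by move=> uw; apply: (vx _ u w); rewrite ?in_CN1 // inE.
have cl_Nb u w : e u w -> cl u \subset Nb w.
  by move=> uw; rewrite /cl /Nb; apply: CNS; rewrite finset.sub1set in_CN1.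
have sp u w : e u w -> spans (lovasz_complex e) (cl u) (Nb w) (Nb w).
  move=> uw; have wu : e w u by rewrite es.
  have [_ vu] := vx1 _ _ uw; have [vw _] := vx1 _ _ wu.
  by apply: spans_lovasz => //; exact: cl_Nb.
pose beta u w := c (cl u) (Nb w).
have betaC u w : e u w -> beta w u = - beta u w.
  move=> uw; have wu : e w u by rewrite es.
  (* [CN] sends the pair ([cl u], [Nb w]) to ([Nb u], [cl w]), the reverse of the pair defining
     [beta w u]. *)
  have : c (CN e (cl u)) (cl w) = beta u w := c_CN _ _ (sp _ _ uw).
  by rewrite /cl CN3 // -/(Nb u) -/(cl w) (cC _ _ (sp _ _ wu)) => <-; rewrite opprK.
(* Passing through [D] splits [beta t z] into a term in [t] plus a term in [z], for [t] among [a],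
   [x] and [z] among [b], [y]; mixed differences therefore vanish. *)
have beta_diff a x y b : [/\ e a b, e x b, e a y & e x y] ->
    beta a b - beta x b = beta a y - beta x y.
  move=> [ab xb ay xy]; pose D := CN e (CN e [set a; x]%SET).
  have inC z : e a z -> e x z -> z \in CN e [set a; x]%SET.
    move=> az xz; rewrite inE; apply/forallP => t; apply/implyP.
    by rewrite !inE => /orP[] /eqP ->.
  have [_ vD] := vx _ _ _ (finset.set21 a x) (inC _ ab xb).
  have E t z : t \in [set a; x]%SET -> e a z -> e x z -> e t z ->
      beta t z = c (cl t) D + c D (Nb z).
    move=> tax az xz tz; rewrite c_trans //.
    have zt : e z t by rewrite es.
    have [_ vt] := vx1 _ _ tz; have [vz _] := vx1 _ _ zt.
    apply: (spans_lovasz vt vD vz); first by apply: CNCNS; rewrite finset.sub1set.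
    by apply: CNS; rewrite finset.sub1set inC.
  rewrite !(E a) ?finset.set21 // !(E x) ?finset.set22 //; ring.
have beta_face f : \sum_(i : 'Z_4) beta (bd f i) (bd f (i + 1)) = 0.
  have [_ ef] := face_4cycle hq f; rewrite sum_Z4.
  have e1 := ef 0; have e2 := ef 1; have e3 := ef 2%:R; have e4 := ef 3%:R.
  have Z1 : 0 + 1 = 1 :> 'Z_4 by apply/val_inj.
  have Z2 : 1 + 1 = 2%:R :> 'Z_4 by apply/val_inj.
  have Z3 : 2%:R + 1 = 3%:R :> 'Z_4 by apply/val_inj.
  have Z4 : 3%:R + 1 = 0 :> 'Z_4 by apply/val_inj.
  rewrite Z1 Z2 Z3 Z4 in e1 e2 e3 e4 *.
  have := @beta_diff (bd f 0) (bd f 2%:R) (bd f 3%:R) (bd f 1).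
  rewrite (betaC _ _ e2) (betaC _ _ e4) opprK => -> ; first ring.
  by split; rewrite // es.
(* The summand 1 appears because [cl w] is the image of [Nb w] under [CN] and so lies over the
   opposite half-circle. *)
have beta_mod2 u w : e u w ->
    (beta u w)%:~R = (up (cl u))%:R + (up (cl w))%:R + 1 :> 'F_2.
  move=> uw; rewrite c_mod2 -addrA; congr (_ + _).
  have wu : e w u by rewrite es.
  have [vw _] := vx1 _ _ wu.
  rewrite /cl up_CN; last exact: spans_lovasz.
  by case: (up _); apply/val_inj.
apply: nor; apply: (cocycle_orientable hq Up p3 betaC beta_face cutp).
have /andP[cyc Uniq] := Up.
(* Modulo 2 the [up] terms cancel after a shift along the cycle, leaving its length, which is
   odd. *)
apply/eqP => /(congr1 (fun z : int => z%:~R : 'F_2)).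
rewrite rmorph_sum /= (eq_bigr (fun u => (up (cl u))%:R + (up (cl (next p u)))%:R + 1)).
  rewrite big_split big_split /=.
  rewrite [X in X + _ + _](reindex_inj (can_inj (prev_next Uniq))) /=.
  rewrite (eq_bigl _ _ (mem_next p)) sumr_const.
  have -> : #|p| = size p by apply/card_uniqP.
  rewrite addrr_F2 add0r -(odd_double_half (size p)) oddp -addnn natrD natrD addrr_F2 addr0.
  by move/(congr1 val).
by move=> u pu; rewrite beta_mod2 //; exact: next_cycle.
Qed.

Theorem theorem1p4 (R : realType) (T F : finType) (e : rel T)
    (bd : F -> 'Z_4 -> T) (hG : odd_quadrangulation bd e)
    (hS : ~ orientable bd) :
  (2%:E <= ind_lovasz R e)%E.
Proof.
apply: le_ereal_inf_tmp => _ [n [f [cf sf nf]] <-]; rewrite lee_fin.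
rewrite ler_nat leqNgt; apply/negP => n2.
have cf_coord i : {within @realization R _ (lovasz_complex e),
    continuous (fun x => f x ord0 i)}%classic.
  move=> x; apply: (@continuous_comp _ _ _ _ (fun y : 'rV_n.+1 => y ord0 i) x (cf x)).
  exact: coord_continuous.
have f_odd i x : realization (lovasz_complex e) x ->
    f (affine_ext (CN e) x) ord0 i = - f x ord0 i.
  by move=> /nf ->; rewrite mxE.
case: n n2 f cf sf nf cf_coord f_odd => [|[|//]] _ f _ sf _ cf_coord f_odd.
(* The 0-sphere is placed in the circle equivariantly by a zero second coordinate. *)
- apply: (no_circle_map (g1 := fun x => f x ord0 ord0) (g2 := cst 0) hG hS).
  + exact: cf_coord.
  + by move=> x; exact: cvg_cst.
  + move=> x /sf; rewrite /sphere /= big_ord_recl big_ord0 addr0.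
    by rewrite /on_circle /= expr0n addr0.
  + by move=> x Xx; rewrite f_odd //= oppr0.
- apply: (no_circle_map (g1 := fun x => f x ord0 ord0)
    (g2 := fun x => f x ord0 (lift ord0 ord0)) hG hS) => //.
  + by move=> x /sf; rewrite /sphere /= !big_ord_recl big_ord0 addr0.
  + by move=> x Xx; rewrite !f_odd.
Qed.
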